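(* Let $M_n$ be the magnetization of the Curie–Weiss model $\mathbb{CW}_{0,1}$. For every relatively compact Borel set $B\subset\mathbb{R}$ whose boundary has Lebesgue measure $0$, $$\lim_{n\to\infty}n^{1/2}\,\mathbb{P}\big[n^{-1/4}M_n\in B\big]=\frac{2}{12^{1/4}\,\Gamma(1/4)}\,m(B),$$ where $m$ is Lebesgue measure.
   Context: The Curie–Weiss measure $\mathbb{CW}_{0,1}$ on $\sigma:\{1,\dots,n\}\to\{\pm1\}$ gives to $\sigma$ probability proportional to $\exp\big(\frac{1}{2n}(\sum_{i=1}^n\sigma(i))^2\big)$; $M_n=\sum_{i=1}^n\sigma(i)$. *)

(* Defs.v *)
From Stdlib Require Import Reals Lra List ClassicalEpsilon.
From Stdlib Require Import Rtopology.
Import ListNotations.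
Open Scope R_scope.

Inductive Borel : (R -> Prop) -> Prop :=
  | Borel_open : forall A, open_set A -> Borel A
  | Borel_compl : forall A, Borel A -> Borel (fun x => ~ A x)
  | Borel_union : forall An : nat -> R -> Prop,
      (forall k, Borel (An k)) -> Borel (fun x => exists k, An k x)
  | Borel_ext : forall A A', Borel A -> (forall x, A x <-> A' x) -> Borel A'.

Definition boundary (A : R -> Prop) (x : R) : Prop :=
  adherence A x /\ ~ interior A x.

Definition relatively_compact (A : R -> Prop) : Prop := compact (adherence A).

Definition interval_cover (A : R -> Prop) (a b : nat -> R) : Prop :=
  (forall k, a k <= b k) /\ (forall x, A x -> exists k, a k < x < b k).

Definition lebesgue_null (A : R -> Prop) : Prop :=
  forall eps, 0 < eps -> exists a b : nat -> R,
    interval_cover A a b /\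
    (forall N, sum_f_R0 (fun k => b k - a k) N < eps).

Definition is_glb (E : R -> Prop) (l : R) : Prop :=
  (forall s, E s -> l <= s) /\ (forall l', (forall s, E s -> l' <= s) -> l' <= l).

(** [lebesgue_measure_is A l]: l is the Lebesgue (outer) measure of A,
    i.e. the infimum of total lengths of countable open-interval covers
    (this equals the Lebesgue measure for Borel A). *)
Definition lebesgue_measure_is (A : R -> Prop) (l : R) : Prop :=
  is_glb (fun s => exists a b : nat -> R,
            interval_cover A a b /\ infinite_sum (fun k => b k - a k) s) l.

Definition improper_integral_0_inf (f : R -> R) (l : R) : Prop :=
  forall eps, 0 < eps -> exists d M, 0 < d /\
    forall a b, 0 < a < d -> M < b ->
      exists pr : Riemann_integrable f a b, Rabs (RiemannInt pr - l) < eps.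

Definition Gamma_is (s g : R) : Prop :=
  improper_integral_0_inf (fun t => Rpower t (s - 1) * exp (- t)) g.

Fixpoint configs (n : nat) : list (list R) :=
  match n with
  | O => [ [] ]
  | S m => map (cons 1) (configs m) ++ map (cons (-1)) (configs m)
  end.

Definition magnetization (s : list R) : R := fold_right Rplus 0 s.

Definition cw_weight (n : nat) (s : list R) : R :=
  exp ((magnetization s) ^ 2 / (2 * INR n)).

Definition indicator (B : R -> Prop) (x : R) : R :=
  if excluded_middle_informative (B x) then 1 else 0.

Definition list_sum (l : list R) : R := fold_right Rplus 0 l.

Definition cw_prob_scaled (n : nat) (B : R -> Prop) : R :=
  list_sum (map (fun s => cw_weight n s *
                   indicator B (Rpower (INR n) (- (1/4)) * magnetization s))
                (configs n))
  / list_sum (map (cw_weight n) (configs n)).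

(* Main.v *)
From Coquelicot Require Import Coquelicot.
From Stdlib Require Import Reals Rtopology Lra Lia List Compare_dec ClassicalEpsilon.
Require Import Defs.
Open Scope R_scope.

(** Put [N = n + 1] and let [a(j) = C(n,j) exp(m^2 / 2n)] be the total weight of the
    configurations with magnetization [m = n - 2j].  The ratio [a(j+1) / a(j)] is
    explicit, and the expansion of [ln ((1+x)/(1-x))] to third order at
    [x = (m-1) / N] shows that [a(j) exp(m^4 / 12N^3 + lower order terms)] is almost
    constant: it is monotone towards the middle, with a summable error.
    No Stirling formula is needed since the constant cancels in the probability.
    - For [m = O(n^(1/4))] the weights are asymptotically equal, so the numerator counts
      the points in [B] of a grid of mesh [2 n^(-1/4)].  As the boundary of [B] is compact
      and null, it has a finite cover of small total length, so [B] is Jordan measurable.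
    - The partition function is a Riemann sum of mesh [h = 2 N^(-3/4)] for
      [f(x) = exp(- x^4 / 12)].  As [f] is Lipschitz, the error over the [N] cells is
      [O(N h^2) = O(N^(-1/2))].
    - The substitution [t = x^4 / 12] identifies the integral of [f] over the half-line
      with [12^(1/4) Gamma(1/4) / 4]. *)

(** * The binomial weights *)

Lemma exp_le_compat (a b : R) : a <= b -> exp a <= exp b.
Proof.
intros [H| ->]; [left; apply exp_increasing, H|right; reflexivity].
Qed.

(** The difference vanishes at [0] and has derivative [2 c^4 / (1 - c^2) >= 0]. This sign makes
    [beta] monotone towards the middle. *)
Lemma ln_ratio_lower (x : R) :
  0 <= x < 1 -> 2 * x + 2 * x ^ 3 / 3 <= ln (1 + x) - ln (1 - x).
Proof.
intros Hx.
destruct (Req_dec x 0) as [->|Hx0].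
{ replace (1 + 0) with (1 - 0) by ring. lra. }
destruct (MVT_cor2 (fun t => ln (1 + t) - ln (1 - t) - 2 * t - 2 * t ^ 3 / 3)
  (fun t => 1 / (1 + t) + 1 / (1 - t) - 2 - 2 * t ^ 2) 0 x) as [c [E Hc]].
- lra.
- intros c Hc. apply is_derive_Reals. auto_derive; [lra|]. field; lra.
- replace (1 + 0) with (1 - 0) in E by ring.
  assert (0 <= 1 / (1 + c) + 1 / (1 - c) - 2 - 2 * c ^ 2).
  { replace (1 / (1 + c) + 1 / (1 - c) - 2 - 2 * c ^ 2)
      with (2 * c ^ 4 / ((1 + c) * (1 - c))) by (field; lra).
    apply Rdiv_le_0_compat; [|nra]. assert (0 <= c ^ 4) by (apply pow_le; lra). lra. }
  nra.
Qed.

(** On [[0, 1/2]] the derivative [2 c^4 / (1 - c^2)] of the remainder stays below [5 c^4], because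
    [c^2 <= 3/5]. *)
Lemma ln_ratio_upper (x : R) :
  0 <= x <= 1 / 2 -> ln (1 + x) - ln (1 - x) <= 2 * x + 2 * x ^ 3 / 3 + x ^ 5.
Proof.
intros Hx.
destruct (Req_dec x 0) as [->|Hx0].
{ replace (1 + 0) with (1 - 0) by ring. lra. }
destruct (MVT_cor2 (fun t => 2 * t + 2 * t ^ 3 / 3 + t ^ 5 - (ln (1 + t) - ln (1 - t)))
  (fun t => 2 + 2 * t ^ 2 + 5 * t ^ 4 - (1 / (1 + t) + 1 / (1 - t))) 0 x) as [c [E Hc]].
- lra.
- intros c Hc. apply is_derive_Reals. auto_derive; [lra|]. field; lra.
- replace (1 + 0) with (1 - 0) in E by ring.
  assert (0 <= 2 + 2 * c ^ 2 + 5 * c ^ 4 - (1 / (1 + c) + 1 / (1 - c))).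
  { replace (2 + 2 * c ^ 2 + 5 * c ^ 4 - (1 / (1 + c) + 1 / (1 - c)))
      with (c ^ 4 * (3 - 5 * c ^ 2) / ((1 + c) * (1 - c))) by (field; lra).
    apply Rdiv_le_0_compat; [|nra]. apply Rmult_le_pos; [apply pow_le; lra|nra]. }
  nra.
Qed.

(** The magnetization when [j] of the [n] spins are [-1]. *)
Definition spin (n j : nat) : R := INR n - 2 * INR j.

Lemma spin_S n j : spin n (S j) = spin n j - 2.
Proof. unfold spin. rewrite S_INR. ring. Qed.

Lemma spin_sub n j : (j <= n)%nat -> spin n (n - j) = - spin n j.
Proof. intros H. unfold spin. rewrite minus_INR by lia. ring. Qed.

Lemma C_pos n j : 0 < Binomial.C n j.
Proof.
unfold Binomial.C. apply Rdiv_lt_0_compat; [apply INR_fact_lt_0|].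
apply Rmult_lt_0_compat; apply INR_fact_lt_0.
Qed.

Lemma C_succ n j : (j < n)%nat ->
  Binomial.C n (S j) = Binomial.C n j * (INR n - INR j) / (INR j + 1).
Proof.
intros H. rewrite pascal_step3 by exact H.
rewrite <- minus_INR by lia. rewrite S_INR. field.
generalize (pos_INR j); lra.
Qed.

Definition weight (n j : nat) : R :=
  Binomial.C n j * exp (spin n j ^ 2 / (2 * INR n)).

(* The correction makes the ratio of consecutive terms equal to
   [(1 + x) / (1 - x) * exp (- 2 x - 2 x^3 / 3)] with [x = (n - 2 j - 1) / (n + 1)],
   i.e. the Taylor remainder of [2 artanh] at order five. *)
Definition beta (n j : nat) : R :=
  let N := INR n + 1 in
  Binomial.C n j *
  exp (spin n j ^ 2 / (2 * N) - spin n j ^ 2 / (6 * N ^ 3) + spin n j ^ 4 / (12 * N ^ 3)).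

Lemma beta_pos n j : 0 < beta n j.
Proof. apply Rmult_lt_0_compat; [apply C_pos|apply exp_pos]. Qed.

(** The spins [m] and [m - 2] of the two terms lie symmetrically about [m - 1 = x N], so the
    exponent changes by an odd polynomial in [x]: the quadratic term gives [-2 x], the quartic one
    [-2 x^3 / 3] and a stray linear term, which the [m^2 / 6N^3] in [beta] cancels. The binomial
    ratio is exactly [(1 + x) / (1 - x)]. *)
Lemma beta_succ n j : (j < n)%nat ->
  let x := (spin n j - 1) / (INR n + 1) in
  -1 < x < 1 /\
  beta n (S j) = beta n j * exp (ln (1 + x) - ln (1 - x) - 2 * x - 2 * x ^ 3 / 3).
Proof.
intros H x.
assert (Hj := pos_INR j). assert (Hn := lt_INR _ _ H).
assert (E1 : 1 + x = 2 * (INR n - INR j) / (INR n + 1)).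
{ unfold x, spin. field. lra. }
assert (E2 : 1 - x = 2 * (INR j + 1) / (INR n + 1)).
{ unfold x, spin. field. lra. }
assert (P1 : 0 < 1 + x) by (rewrite E1; apply Rdiv_lt_0_compat; lra).
assert (P2 : 0 < 1 - x) by (rewrite E2; apply Rdiv_lt_0_compat; lra).
split; [lra|].
unfold beta. rewrite C_succ by exact H. rewrite spin_S.
replace (ln (1 + x) - ln (1 - x) - 2 * x - 2 * x ^ 3 / 3)
  with (ln (1 + x) + - ln (1 - x) + (- 2 * x - 2 * x ^ 3 / 3)) by ring.
rewrite !(exp_plus (ln (1 + x) + _)), (exp_plus (ln (1 + x))), exp_Ropp, !exp_ln by assumption.
rewrite Rmult_assoc.
replace ((spin n j - 2) ^ 2 / (2 * (INR n + 1)) -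
     (spin n j - 2) ^ 2 / (6 * (INR n + 1) ^ 3) +
     (spin n j - 2) ^ 4 / (12 * (INR n + 1) ^ 3)) with
 (spin n j ^ 2 / (2 * (INR n + 1)) - spin n j ^ 2 / (6 * (INR n + 1) ^ 3) +
   spin n j ^ 4 / (12 * (INR n + 1) ^ 3) + (- 2 * x - 2 * x ^ 3 / 3)).
2:{ unfold x. field. lra. }
rewrite exp_plus, E1, E2. field. lra.
Qed.

Lemma C_sym n j : (j <= n)%nat -> Binomial.C n (n - j) = Binomial.C n j.
Proof. intros H. symmetry. apply pascal_step1. exact H. Qed.

Lemma beta_sym n j : (j <= n)%nat -> beta n (n - j) = beta n j.
Proof.
intros H. unfold beta. rewrite C_sym, spin_sub by exact H. f_equal. f_equal.
field. generalize (pos_INR n); lra.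
Qed.

(** Common reference for all weights. It cancels between the numerator and the partition function,
    so its size never has to be estimated. *)
Definition center (n : nat) : R := beta n (n / 2).

Lemma center_pos n : 0 < center n.
Proof. apply beta_pos. Qed.

(** Induction from the middle down to [0], then reflection of [j] to [n - j]. Only steps with
    [spin n j >= 1] occur, so that [x >= 0] in [beta_succ]. *)
Lemma half_ind (n : nat) (P : nat -> Prop) :
  P (n / 2)%nat ->
  (forall j, (j < n)%nat -> 1 <= spin n j -> P (S j) -> P j) ->
  (forall j, (j <= n)%nat -> P j -> P (n - j)%nat) ->
  forall j, (j <= n)%nat -> P j.
Proof.
intros H0 Hs Hsym.
assert (Hn : (2 * (n / 2) <= n <= 2 * (n / 2) + 1)%nat).
{ generalize (Nat.div_mod_eq n 2), (Nat.mod_upper_bound n 2). lia. }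
assert (Hlow : forall d j, (j + d = n / 2)%nat -> P j).
{ induction d as [|d IH]; intros j Hj.
  - replace j with (n / 2)%nat by lia. exact H0.
  - apply Hs; [lia| |apply IH; lia].
    unfold spin. assert (2 * j + 1 <= n)%nat as Hjn by lia. apply le_INR in Hjn.
    rewrite plus_INR, mult_INR in Hjn. simpl in Hjn. lra. }
intros j Hj. destruct (Nat.le_gt_cases j (n / 2)) as [Hl|Hg].
- apply (Hlow (n / 2 - j)%nat). lia.
- replace j with (n - (n - j))%nat by lia. apply Hsym; [lia|].
  apply (Hlow (n / 2 - (n - j))%nat). lia.
Qed.

Lemma beta_le_center n j : (j <= n)%nat -> beta n j <= center n.
Proof.
apply (half_ind n (fun j => beta n j <= center n)).
- right; reflexivity.
- intros i Hi Hs IH. destruct (beta_succ n i Hi) as [Hx E]. rewrite E in IH.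
  set (x := (spin n i - 1) / (INR n + 1)) in *.
  assert (0 <= x) by (apply Rdiv_le_0_compat; generalize (pos_INR n); lra).
  assert (L := ln_ratio_lower x).
  assert (1 <= exp (ln (1 + x) - ln (1 - x) - 2 * x - 2 * x ^ 3 / 3)).
  { rewrite <- exp_0 at 1. apply exp_le_compat. lra. }
  eapply Rle_trans; [|exact IH].
  rewrite <- (Rmult_1_r (beta n i)) at 1.
  apply Rmult_le_compat_l; [left; apply beta_pos|assumption].
- intros i Hi. rewrite beta_sym by exact Hi. easy.
Qed.

(** One step towards the middle gains at most a factor [exp (x^5)]. With [u = x N] the gains
    telescope, as [12 u^5 <= (u + 1)^6 - (u - 1)^6], so that their exponents add up to at most
    [m^6 / 12N^5]. The bound on the spin keeps [x <= 1/2]. *)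
Lemma center_le_beta n j : (j <= n)%nat -> Rabs (spin n j) <= (INR n + 1) / 2 ->
  center n <= beta n j * exp (spin n j ^ 6 / (12 * (INR n + 1) ^ 5)).
Proof.
assert (HN := pos_INR n).
assert (HN5 : 0 < (INR n + 1) ^ 5) by (apply pow_lt; lra).
assert (H6 : forall t, 0 <= t ^ 6 / (12 * (INR n + 1) ^ 5)).
{ intros t. apply Rdiv_le_0_compat; [|lra]. replace (t ^ 6) with ((t ^ 3) ^ 2) by ring.
  apply pow2_ge_0. }
apply (half_ind n (fun j => Rabs (spin n j) <= (INR n + 1) / 2 ->
  center n <= beta n j * exp (spin n j ^ 6 / (12 * (INR n + 1) ^ 5)))).
- intros _. fold (center n). generalize (exp_le_compat _ _ (H6 (spin n (n / 2)))) (center_pos n).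
  rewrite exp_0. nra.
- intros i Hi Hs IH Hb. destruct (beta_succ n i Hi) as [Hx E].
  rewrite E, spin_S in IH.
  set (x := (spin n i - 1) / (INR n + 1)) in *.
  rewrite Rabs_pos_eq in Hb by lra.
  assert (Ex : spin n i = x * (INR n + 1) + 1) by (unfold x; field; lra).
  assert (0 <= x) by (apply Rdiv_le_0_compat; lra).
  assert (x <= 1 / 2).
  { apply Rmult_le_reg_r with (INR n + 1); lra. }
  assert (L := ln_ratio_upper x ltac:(lra)).
  eapply Rle_trans; [apply IH|].
  { apply Rabs_le; lra. }
  rewrite Rmult_assoc, <- exp_plus. apply Rmult_le_compat_l; [left; apply beta_pos|].
  apply exp_le_compat.
  enough ((spin n i - 2) ^ 6 / (12 * (INR n + 1) ^ 5) + x ^ 5 <=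
          spin n i ^ 6 / (12 * (INR n + 1) ^ 5)) by lra.
  apply Rmult_le_reg_r with (12 * (INR n + 1) ^ 5); [lra|].
  replace (((spin n i - 2) ^ 6 / (12 * (INR n + 1) ^ 5) + x ^ 5) * (12 * (INR n + 1) ^ 5))
    with ((spin n i - 2) ^ 6 + 12 * (x * (INR n + 1)) ^ 5) by (field; lra).
  replace (spin n i ^ 6 / (12 * (INR n + 1) ^ 5) * (12 * (INR n + 1) ^ 5))
    with (spin n i ^ 6) by (field; lra).
  rewrite Ex. set (u := x * (INR n + 1)).
  assert (0 <= u) by (apply Rmult_le_pos; lra).
  assert (0 <= u ^ 3) by (apply pow_le; assumption).
  replace ((u + 1) ^ 6) with ((u + 1 - 2) ^ 6 + 12 * u ^ 5 + 40 * u ^ 3 + 12 * u) by ring.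
  lra.
- intros i Hi. rewrite beta_sym, spin_sub, Rabs_Ropp by exact Hi.
  replace ((- spin n i) ^ 6) with (spin n i ^ 6) by ring. easy.
Qed.

(** Passing from [1 / 2n] to [1 / 2N] costs the last term, since [1/n - 1/N = 1 / nN]; the other two
    terms undo the correction in [beta]. *)
Lemma weight_beta n j : (0 < n)%nat ->
  weight n j = beta n j *
    exp (- (spin n j ^ 4 / (12 * (INR n + 1) ^ 3)) + spin n j ^ 2 / (6 * (INR n + 1) ^ 3)
         + spin n j ^ 2 / (2 * INR n * (INR n + 1))).
Proof.
intros H. apply lt_INR in H. simpl in H.
unfold weight, beta. rewrite Rmult_assoc, <- exp_plus. f_equal. f_equal. field. lra.
Qed.

Lemma weight_upper n j : (0 < n)%nat -> (j <= n)%nat ->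
  weight n j / center n <=
    exp (- (spin n j ^ 4 / (12 * (INR n + 1) ^ 3)) + spin n j ^ 2 / (6 * (INR n + 1) ^ 3)
         + spin n j ^ 2 / (2 * INR n * (INR n + 1))).
Proof.
intros Hn Hj. rewrite weight_beta by exact Hn.
apply Rle_div_l; [apply center_pos|]. rewrite Rmult_comm.
apply Rmult_le_compat_l; [left; apply exp_pos|apply beta_le_center, Hj].
Qed.

Lemma weight_lower n j : (0 < n)%nat -> (j <= n)%nat ->
  Rabs (spin n j) <= (INR n + 1) / 2 ->
  exp (- (spin n j ^ 4 / (12 * (INR n + 1) ^ 3)) - spin n j ^ 6 / (12 * (INR n + 1) ^ 5))
   <= weight n j / center n.
Proof.
intros Hn Hj Hs. rewrite weight_beta by exact Hn.
assert (Hb := center_le_beta n j Hj Hs).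
apply Rle_div_r; [apply center_pos|].
apply lt_INR in Hn. simpl in Hn.
assert (0 <= spin n j ^ 2 / (6 * (INR n + 1) ^ 3)).
{ apply Rdiv_le_0_compat; [apply pow2_ge_0|]. apply Rmult_lt_0_compat; [lra|apply pow_lt; lra]. }
assert (0 <= spin n j ^ 2 / (2 * INR n * (INR n + 1))).
{ apply Rdiv_le_0_compat; [apply pow2_ge_0|]. apply Rmult_lt_0_compat; lra. }
eapply Rle_trans; [apply Rmult_le_compat_l; [left; apply exp_pos|apply Hb]|].
rewrite (Rmult_comm (beta n j)), <- Rmult_assoc, <- exp_plus, Rmult_comm.
apply Rmult_le_compat_l; [left; apply beta_pos|]. apply exp_le_compat. lra.
Qed.

(** * Summation over configurations *)

Lemma sum_C_succ (n : nat) (F : nat -> R) :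
  sum_f_R0 (fun j => Binomial.C (S n) j * F j) (S n) =
  sum_f_R0 (fun j => Binomial.C n j * (F j + F (S j))) n.
Proof.
assert (C0 : forall m, Binomial.C m 0 = 1).
{ intros m. unfold Binomial.C. rewrite Nat.sub_0_r. simpl. field. apply INR_fact_neq_0. }
assert (Cn : forall m, Binomial.C m m = 1).
{ intros m. rewrite <- (C0 m), <- (C_sym m m) by lia. f_equal. lia. }
(* For partial sums Pascal's rule leaves a boundary term; at [k = n] it is cancelled by the last
   term [j = n + 1]. *)
assert (H : forall k, (k <= n)%nat ->
  sum_f_R0 (fun j => Binomial.C (S n) j * F j) k =
  sum_f_R0 (fun j => Binomial.C n j * (F j + F (S j))) k - Binomial.C n k * F (S k)).
{ induction k as [|k IH]; intros Hk.
  - simpl. rewrite !C0. ring.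
  - rewrite !tech5, IH, <- pascal by lia. ring. }
rewrite tech5, H, !Cn by lia. ring.
Qed.

Lemma list_sum_app l l' : list_sum (l ++ l') = list_sum l + list_sum l'.
Proof. induction l as [|x l IH]; simpl; [|unfold list_sum in *; simpl; rewrite IH]; ring. Qed.

(** Fixing the first spin shifts the argument of [F] by [1] or [-1], so the induction needs
    arbitrary [F]; adding the two halves is Pascal's rule. *)
Lemma sum_configs (n : nat) (F : R -> R) :
  list_sum (map (fun s => F (magnetization s)) (configs n)) =
  sum_f_R0 (fun j => Binomial.C n j * F (spin n j)) n.
Proof.
revert F. induction n as [|n IH]; intros F.
- unfold list_sum, magnetization, spin, Binomial.C. simpl.
  replace (0 - 2 * 0) with 0 by ring. field.
- simpl configs. rewrite map_app, !map_map, list_sum_app.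
  etransitivity.
  { exact (f_equal2 Rplus (IH (fun y => F (1 + y))) (IH (fun y => F (-1 + y)))). }
  rewrite (sum_C_succ n (fun j => F (spin (S n) j))), <- sum_plus.
  apply sum_eq. intros j Hj. unfold spin. rewrite !S_INR.
  replace (1 + (INR n - 2 * INR j)) with (INR n + 1 - 2 * INR j) by ring.
  replace (-1 + (INR n - 2 * INR j)) with (INR n + 1 - 2 * (INR j + 1)) by ring.
  ring.
Qed.

Lemma cw_prob_scaled_weight (n : nat) (B : R -> Prop) :
  cw_prob_scaled n B =
  sum_f_R0 (fun j => weight n j / center n *
              indicator B (Rpower (INR n) (- (1 / 4)) * spin n j)) n /
  sum_f_R0 (fun j => weight n j / center n) n.
Proof.
unfold cw_prob_scaled, cw_weight.
rewrite (sum_configs n (fun y => exp (y ^ 2 / (2 * INR n)) *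
  indicator B (Rpower (INR n) (- (1 / 4)) * y))).
rewrite (sum_configs n (fun y => exp (y ^ 2 / (2 * INR n)))).
assert (Hc := center_pos n).
set (D := sum_f_R0 (fun j => Binomial.C n j * exp (spin n j ^ 2 / (2 * INR n))) n).
assert (HD : 0 < D).
{ unfold D. apply tech1. intros k _. apply Rmult_lt_0_compat; [apply C_pos|apply exp_pos]. }
replace (sum_f_R0 (fun j => weight n j / center n) n) with (/ center n * D).
2:{ unfold D. rewrite scal_sum. apply sum_eq. intros j _. unfold weight, Rdiv. ring. }
rewrite (sum_eq (fun j => weight n j / center n * _)
  (fun j => (Binomial.C n j * (exp (spin n j ^ 2 / (2 * INR n)) *
     indicator B (Rpower (INR n) (- (1 / 4)) * spin n j))) * / center n))
  by (intros j _; unfold weight, Rdiv; ring).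
rewrite <- scal_sum. field. lra.
Qed.

(** * The quartic exponential and the Gamma integral *)

(** With [m = x N^(3/4)] the term [m^4 / 12N^3] in the exponent of the weights becomes
    [x^4 / 12]. *)
Definition quartic (x : R) : R := exp (- (x ^ 4 / 12)).

Definition quartic_int (x : R) : R := RInt quartic 0 x.

Lemma continuous_quartic x : continuous quartic x.
Proof. apply (ex_derive_continuous (V := R_NormedModule)). unfold quartic. auto_derive. easy. Qed.

Lemma is_derive_quartic_int x : is_derive quartic_int x (quartic x).
Proof.
apply (is_derive_RInt quartic quartic_int 0); [|apply continuous_quartic].
exists (mkposreal 1 Rlt_0_1). intros y _.
apply (RInt_correct (V := R_CompleteNormedModule)), (ex_RInt_continuous (V := R_CompleteNormedModule)).
intros z _. apply continuous_quartic.
Qed.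

Lemma quartic_int_0 : quartic_int 0 = 0.
Proof. apply (RInt_point (V := R_CompleteNormedModule)). Qed.

Lemma quartic_pos x : 0 < quartic x.
Proof. apply exp_pos. Qed.

Lemma pow4_ge_0 x : 0 <= x ^ 4.
Proof. replace (x ^ 4) with ((x ^ 2) ^ 2) by ring. apply pow2_ge_0. Qed.

Lemma quartic_le_1 x : quartic x <= 1.
Proof. rewrite <- exp_0. apply exp_le_compat. generalize (pow4_ge_0 x). lra. Qed.

Lemma quartic_int_MVT a b : a < b ->
  exists c, quartic_int b - quartic_int a = quartic c * (b - a) /\ a < c < b.
Proof.
intros H. apply MVT_cor2; [exact H|]. intros c _. apply is_derive_Reals, is_derive_quartic_int.
Qed.

Lemma quartic_int_opp x : quartic_int (- x) = - quartic_int x.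
Proof.
assert (H : forall y, 0 < y -> quartic_int (- y) = - quartic_int y).
{ intros y Hy.
  destruct (MVT_cor2 (fun t => quartic_int t + quartic_int (- t)) (fun _ => 0) 0 y Hy)
    as [c [E _]].
  - intros c _. apply is_derive_Reals.
    replace 0 with (quartic c + (-1) * quartic (- c)).
    2:{ unfold quartic. replace ((- c) ^ 4) with (c ^ 4) by ring. ring. }
    apply (is_derive_plus (V := R_NormedModule)); [apply is_derive_quartic_int|].
    apply (is_derive_comp (V := R_NormedModule) quartic_int Ropp);
      [apply is_derive_quartic_int|].
    auto_derive; [easy|ring].
  - rewrite Ropp_0, quartic_int_0 in E. lra. }
destruct (Rtotal_order x 0) as [Hx|[->|Hx]].
- rewrite <- (Ropp_involutive x) at 2. rewrite (H (- x)) by lra. ring.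
- rewrite Ropp_0, quartic_int_0. ring.
- apply H, Hx.
Qed.

Lemma quartic_int_lt x : 0 < x -> 0 < quartic_int x <= x.
Proof.
intros Hx. destruct (quartic_int_MVT 0 x Hx) as [c [E _]]. rewrite quartic_int_0 in E.
generalize (quartic_pos c) (quartic_le_1 c). nra.
Qed.

(** The derivative is bounded: [exp (- t) <= 1 / (1 + t)] at [t = c^4 / 12], together with
    [|c|^3 <= 1 + c^4], gives the crude constant [4]. *)
Lemma quartic_Lipschitz x y : Rabs (quartic x - quartic y) <= 4 * Rabs (x - y).
Proof.
assert (D : forall c, Rabs (- (c ^ 3 / 3) * quartic c) <= 4).
{ intros c. rewrite Rabs_mult, (Rabs_pos_eq (quartic c)) by (left; apply quartic_pos).
  assert (Hq : quartic c <= / (1 + c ^ 4 / 12)).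
  { unfold quartic. rewrite exp_Ropp. apply Rinv_le_contravar; [|apply exp_ineq1_le].
    generalize (pow4_ge_0 c). lra. }
  assert (Hc : Rabs (- (c ^ 3 / 3)) <= 4 * (1 + c ^ 4 / 12)).
  { assert (Hs : Rabs c ^ 4 = c ^ 4).
    { rewrite RPow_abs. apply Rabs_pos_eq, pow4_ge_0. }
    rewrite Rabs_Ropp. unfold Rdiv at 1. rewrite Rabs_mult, <- RPow_abs, (Rabs_pos_eq (/ 3)) by lra.
    rewrite <- Hs. generalize (Rabs_pos c). intros. set (t := Rabs c) in *.
    assert (0 <= t ^ 3) by (apply pow_le; assumption).
    assert (t ^ 3 <= 1 + t ^ 4).
    { destruct (Rle_dec t 1) as [Hl|Hl].
      - assert (t ^ 3 <= 1) by (rewrite <- (pow1 3); apply pow_incr; lra).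
        generalize (pow4_ge_0 t). lra.
      - replace (t ^ 4) with (t * t ^ 3) by ring. nra. }
    lra. }
  assert (P : 0 < 1 + c ^ 4 / 12) by (generalize (pow4_ge_0 c); lra).
  eapply Rle_trans.
  { apply Rmult_le_compat; [apply Rabs_pos|left; apply quartic_pos|exact Hc|exact Hq]. }
  right. field. lra. }
assert (W : forall a b, a < b -> Rabs (quartic b - quartic a) <= 4 * Rabs (b - a)).
{ intros a b Hab.
  destruct (MVT_cor2 quartic (fun c => - (c ^ 3 / 3) * quartic c) a b Hab) as [c [E _]].
  - intros c _. apply is_derive_Reals. unfold quartic. auto_derive; [easy|].
    replace (c * (c * (c * (c * 1))) * / 12) with (c ^ 4 / 12) by field. field.
  - rewrite E, Rabs_mult. apply Rmult_le_compat_r; [apply Rabs_pos|apply D]. }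
destruct (Rtotal_order x y) as [H|[->|H]].
- rewrite Rabs_minus_sym, (Rabs_minus_sym x). apply W, H.
- rewrite !Rminus_diag, Rabs_R0. lra.
- apply W, H.
Qed.

Lemma Rpower_4_quarter x : 0 < x -> Rpower (x ^ 4) (1 / 4) = x.
Proof.
intros H. rewrite <- Rpower_pow, Rpower_mult by assumption.
replace (INR 4 * (1 / 4)) with 1 by (simpl; field). apply Rpower_1, H.
Qed.

Lemma Rpower_quarter_4 x : 0 < x -> Rpower x (1 / 4) ^ 4 = x.
Proof.
intros H. rewrite <- Rpower_pow, Rpower_mult by apply exp_pos.
replace (1 / 4 * INR 4) with 1 by (simpl; field). apply Rpower_1, H.
Qed.

(* Substitution [t = x^4 / 12] in the Gamma integral. *)
Lemma RInt_Gamma_quarter y x : 0 < y < x ->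
  RInt (fun t => Rpower t (1 / 4 - 1) * exp (- t)) (y ^ 4 / 12) (x ^ 4 / 12) =
  4 / Rpower 12 (1 / 4) * (quartic_int x - quartic_int y).
Proof.
intros [Hy Hyx].
set (p := Rpower 12 (1 / 4)).
assert (Hp : 0 < p) by apply exp_pos.
assert (Hp4 : p ^ 4 = 12) by (apply Rpower_quarter_4; lra).
assert (E : forall z, 0 < z -> p * Rpower (z ^ 4 / 12) (1 / 4) = z).
{ intros z Hz. unfold p. rewrite Rpower_mult_distr; [|lra|].
  - replace (12 * (z ^ 4 / 12)) with (z ^ 4) by field. apply Rpower_4_quarter, Hz.
  - apply Rdiv_lt_0_compat; [apply pow_lt, Hz|lra]. }
assert (Hy4 : 0 < y ^ 4 / 12) by (apply Rdiv_lt_0_compat; [apply pow_lt, Hy|lra]).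
assert (Hyx4 : y ^ 4 / 12 <= x ^ 4 / 12).
{ apply Rmult_le_compat_r; [lra|]. apply pow_incr. lra. }
apply is_RInt_unique.
set (F := fun t => 4 / p * quartic_int (p * Rpower t (1 / 4))).
replace (4 / p * (quartic_int x - quartic_int y)) with (F (x ^ 4 / 12) - F (y ^ 4 / 12))
  by (unfold F; rewrite !E by lra; ring).
apply (is_RInt_derive (V := R_CompleteNormedModule)); rewrite Rmin_left, Rmax_right by assumption.
- intros t Ht.
  replace (Rpower t (1 / 4 - 1) * exp (- t)) with
    (4 / p * ((p * (1 / 4 * Rpower t (1 / 4 - 1))) * quartic (p * Rpower t (1 / 4)))).
  2:{ unfold quartic. rewrite Rpow_mult_distr, Rpower_quarter_4, Hp4 by lra.
      replace (12 * t / 12) with t by field. field. lra. }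
  apply (is_derive_scal (fun t => quartic_int (p * Rpower t (1 / 4)))).
  apply (is_derive_comp (V := R_NormedModule) quartic_int (fun t => p * Rpower t (1 / 4)));
    [apply is_derive_quartic_int|].
  apply (is_derive_scal (fun t => Rpower t (1 / 4))).
  apply is_derive_Reals, derivable_pt_lim_power. lra.
- intros t Ht. apply (ex_derive_continuous (V := R_NormedModule)).
  unfold Rpower. auto_derive. lra.
Qed.

Lemma quartic_int_lim g : Gamma_is (1 / 4) g ->
  is_lim quartic_int p_infty (Rpower 12 (1 / 4) * g / 4).
Proof.
intros Hg. set (p := Rpower 12 (1 / 4)).
assert (Hp : 0 < p) by apply exp_pos.
apply is_lim_spec. intros eps.
(* The factor [p / 4] of the substitution turns this tolerance into [eps / 2]. *)
assert (He : 0 < 2 / p * eps).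
{ apply Rmult_lt_0_compat; [apply Rdiv_lt_0_compat; lra|apply eps]. }
destruct (Hg _ He) as [d [M [Hd H]]].
(* [y <= 1] and [y <= d] put [y^4 / 12] below [d], and [y <= eps / 2] bounds the piece
   [quartic_int y] cut off near [0]. *)
set (y := Rmin 1 (Rmin d (eps / 2))).
assert (Hy : 0 < y /\ y <= 1 /\ y <= d /\ y <= eps / 2).
{ generalize (cond_pos eps). unfold y, Rmin. repeat destruct Rle_dec; lra. }
destruct Hy as [Hy0 [Hy1 [Hyd Hye]]].
exists (Rmax 1 (12 * M)). intros x Hx.
assert (Hx1 : 1 < x) by (generalize (Rmax_l 1 (12 * M)); lra).
assert (Hx2 : 12 * M < x) by (generalize (Rmax_r 1 (12 * M)); lra).
assert (Hx4 : x <= x ^ 4) by (rewrite <- (pow_1 x) at 1; apply Rle_pow; [lra|lia]).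
assert (Hy4 : y ^ 4 <= y).
{ assert (y ^ 3 <= 1) by (rewrite <- (pow1 3); apply pow_incr; lra).
  replace (y ^ 4) with (y ^ 3 * y) by ring. nra. }
assert (0 < y ^ 4) by (apply pow_lt, Hy0).
destruct (H (y ^ 4 / 12) (x ^ 4 / 12)) as [pr Hpr]; [lra|lra|].
rewrite <- RInt_Reals, RInt_Gamma_quarter in Hpr by lra. fold p in Hpr.
assert (Hiy := quartic_int_lt y Hy0).
assert (Hs : Rabs (quartic_int x - quartic_int y - p * g / 4) < eps / 2).
{ replace (quartic_int x - quartic_int y - p * g / 4) with
    (p / 4 * (4 / p * (quartic_int x - quartic_int y) - g)) by (field; lra).
  rewrite Rabs_mult, (Rabs_pos_eq (p / 4)) by lra.
  replace (eps / 2) with (p / 4 * (2 / p * eps)) by (field; lra).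
  apply Rmult_lt_compat_l; lra. }
apply Rabs_def2 in Hs. apply Rabs_def1; lra.
Qed.

(** * The partition function *)

Lemma quartic_int_step l h x : 0 < l -> 0 < h ->
  Rabs (h * quartic (l * x) - (quartic_int (l * x) - quartic_int (l * (x - h))) / l)
    <= 4 * l * h ^ 2.
Proof.
intros Hl Hh.
destruct (quartic_int_MVT (l * (x - h)) (l * x)) as [c [E Hc]]; [nra|].
rewrite E.
replace (h * quartic (l * x) - quartic c * (l * x - l * (x - h)) / l)
  with (h * (quartic (l * x) - quartic c)) by (field; lra).
rewrite Rabs_mult, Rabs_pos_eq by lra.
assert (L := quartic_Lipschitz (l * x) c).
rewrite (Rabs_pos_eq (l * x - c)) in L by lra.
apply Rle_trans with (h * (4 * (l * h))); [|right; ring].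
apply Rmult_le_compat_l; [lra|]. nra.
Qed.

(** The grid runs downwards from [x], as the spins do in [j]. Its [n + 1] points are the right ends
    of [n + 1] cells, whose integrals telescope down to [x - (n + 1) h]. *)
Lemma quartic_riemann_sum l h x n : 0 < l -> 0 < h ->
  Rabs (sum_f_R0 (fun j => h * quartic (l * (x - INR j * h))) n -
        (quartic_int (l * x) - quartic_int (l * (x - INR (S n) * h))) / l)
    <= INR (S n) * (4 * l * h ^ 2).
Proof.
intros Hl Hh. induction n as [|n IH].
- simpl sum_f_R0. replace (INR 1) with 1 by reflexivity. simpl (INR 0).
  replace (x - 0 * h) with x by ring.
  generalize (quartic_int_step l h x Hl Hh). rewrite !Rmult_1_l. easy.
- rewrite tech5.
  assert (T := quartic_int_step l h (x - INR (S n) * h) Hl Hh).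
  replace (x - INR (S n) * h - h) with (x - INR (S (S n)) * h) in T
    by (rewrite (S_INR (S n)); ring).
  apply Rabs_le_between in IH. apply Rabs_le_between in T.
  rewrite (S_INR (S n)) in *. unfold Rdiv in *. apply Rabs_le. lra.
Qed.

(** This is [N^(1/4)]; the values [spin n j / root4 n ^ 3] form a grid of mesh [2 N^(-3/4)]. *)
Definition root4 (n : nat) : R := Rpower (INR n + 1) (1 / 4).

Lemma root4_pow4 n : root4 n ^ 4 = INR n + 1.
Proof. apply Rpower_quarter_4. generalize (pos_INR n). lra. Qed.

Lemma root4_pos n : 0 < root4 n.
Proof. apply exp_pos. Qed.

Lemma is_lim_seq_root4 : is_lim_seq root4 p_infty.
Proof.
apply is_lim_seq_spec. intros M.
destruct (INR_unbounded ((Rabs M + 1) ^ 4)) as [n0 Hn0].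
exists n0. intros n Hn. apply le_INR in Hn.
destruct (Rle_lt_dec (root4 n) M) as [H|H]; [exfalso|exact H].
assert (root4 n ^ 4 <= (Rabs M + 1) ^ 4).
{ apply pow_incr. generalize (root4_pos n) (Rle_abs M). lra. }
rewrite root4_pow4 in *. lra.
Qed.

Lemma root4_eventually M : eventually (fun n => M < root4 n).
Proof. exact (proj2 (is_lim_seq_spec _ _) is_lim_seq_root4 M). Qed.

Lemma is_lim_seq_div_root4 c k : is_lim_seq (fun n => c / root4 n ^ S k) 0.
Proof.
assert (H : is_lim_seq (fun n => / root4 n) 0).
{ replace (Finite 0) with (Rbar_inv p_infty) by reflexivity.
  apply is_lim_seq_inv; [apply is_lim_seq_root4|easy]. }
assert (Hk : is_lim_seq (fun n => (/ root4 n) ^ S k) 0).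
{ induction k as [|k IH].
  - apply is_lim_seq_ext with (2 := H). intros n. simpl. ring.
  - replace (Finite 0) with (Finite (0 * 0)) by (f_equal; ring).
    apply (is_lim_seq_mult' (fun n => / root4 n) (fun n => (/ root4 n) ^ S k)); assumption. }
apply is_lim_seq_ext with (fun n => c * (/ root4 n) ^ S k).
- intros n. rewrite pow_inv. reflexivity.
- replace (Finite 0) with (Rbar_mult c 0) by (simpl; f_equal; ring).
  apply is_lim_seq_scal_l, Hk.
Qed.

Lemma is_lim_seq_exp u l : is_lim_seq u (Finite l) -> is_lim_seq (fun n => exp (u n)) (exp l).
Proof.
apply is_lim_seq_continuous. apply derivable_continuous_pt, derivable_pt_exp.
Qed.

Lemma is_lim_seq_sqrt_1 u : is_lim_seq u 1 -> is_lim_seq (fun n => sqrt (u n)) 1.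
Proof.
intros H. replace (Finite 1) with (Finite (sqrt 1)) by (f_equal; apply sqrt_1).
apply is_lim_seq_continuous; [|exact H].
apply derivable_continuous_pt, derivable_pt_sqrt. lra.
Qed.

(** The factor [l n], tending to [1], leaves room for the perturbed exponents in the bounds on the
    weights. Both ends of the grid go to infinity like [root4 n], while the error of the Riemann sum
    is [16 l / root4^2]. *)
Lemma quartic_sum_lim (l : nat -> R) (I : R) :
  is_lim quartic_int p_infty I -> is_lim_seq l 1 -> eventually (fun n => 0 < l n) ->
  is_lim_seq (fun n => sum_f_R0 (fun j =>
     2 / root4 n ^ 3 * quartic (l n * (spin n j / root4 n ^ 3))) n) (2 * I).
Proof.
intros HI Hl Hlpos.
assert (HG : forall c : R, is_lim_seq (fun n => quartic_int (l n * ((INR n + c) / root4 n ^ 3))) I).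
{ intros c. apply (is_lim_comp_seq quartic_int _ p_infty I HI); [now exists 0%nat|].
  apply is_lim_seq_mult with (l1 := Finite 1) (l2 := p_infty); [exact Hl| |].
  - apply is_lim_seq_ext with (fun n => root4 n + (c - 1) / root4 n ^ 3).
    + intros n. replace (INR n) with (root4 n ^ 4 - 1) by (rewrite root4_pow4; ring).
      generalize (root4_pos n); intros. field. lra.
    + apply is_lim_seq_plus with (l1 := p_infty) (l2 := Finite 0);
        [apply is_lim_seq_root4|apply is_lim_seq_div_root4|easy].
  - apply is_Rbar_mult_sym, is_Rbar_mult_p_infty_pos. simpl. lra. }
assert (HM : is_lim_seq (fun n => (quartic_int (l n * ((INR n + 0) / root4 n ^ 3)) +
   quartic_int (l n * ((INR n + 2) / root4 n ^ 3))) / l n) (2 * I)).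
{ replace (Finite (2 * I)) with (Finite ((I + I) / 1)) by (f_equal; field).
  apply is_lim_seq_div'; [|exact Hl|lra].
  apply is_lim_seq_plus'; apply HG. }
assert (HE : is_lim_seq (fun n => l n * (16 / root4 n ^ 2)) 0).
{ replace (Finite 0) with (Finite (1 * 0)) by (f_equal; ring).
  apply is_lim_seq_mult'; [exact Hl|apply is_lim_seq_div_root4]. }
assert (Hclose : eventually (fun n =>
  Rabs (sum_f_R0 (fun j => 2 / root4 n ^ 3 * quartic (l n * (spin n j / root4 n ^ 3))) n -
   (quartic_int (l n * ((INR n + 0) / root4 n ^ 3)) +
   quartic_int (l n * ((INR n + 2) / root4 n ^ 3))) / l n) <= l n * (16 / root4 n ^ 2))).
{ destruct Hlpos as [n0 H0]. exists n0. intros n Hn. specialize (H0 n Hn).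
  assert (Hr := root4_pos n). assert (Hr3 : 0 < root4 n ^ 3) by (apply pow_lt, Hr).
  assert (Hh : 0 < 2 / root4 n ^ 3) by (apply Rdiv_lt_0_compat; lra).
  assert (T := quartic_riemann_sum (l n) _ ((INR n + 0) / root4 n ^ 3) n H0 Hh).
  (* The lowest cell ends at [(n - 2 (n + 1)) / root4^3], whence the [n + 2]; oddness of
     [quartic_int] turns the difference into a sum. *)
  replace (l n * ((INR n + 0) / root4 n ^ 3 - INR (S n) * (2 / root4 n ^ 3))) with
    (- (l n * ((INR n + 2) / root4 n ^ 3))) in T by (rewrite S_INR; field; lra).
  rewrite quartic_int_opp in T.
  replace (INR (S n) * (4 * l n * (2 / root4 n ^ 3) ^ 2)) with (l n * (16 / root4 n ^ 2)) in T
    by (rewrite S_INR, <- root4_pow4; field; lra).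
  assert (Hm : forall u v, u - - v = u + v) by (intros; ring). rewrite Hm in T.
  rewrite (sum_eq _ (fun j => 2 / root4 n ^ 3 *
     quartic (l n * ((INR n + 0) / root4 n ^ 3 - INR j * (2 / root4 n ^ 3))))).
  - exact T.
  - intros j _. do 3 f_equal. unfold spin. field. lra. }
apply is_lim_seq_le_le_loc with
  (u := fun n => (quartic_int (l n * ((INR n + 0) / root4 n ^ 3)) +
   quartic_int (l n * ((INR n + 2) / root4 n ^ 3))) / l n - l n * (16 / root4 n ^ 2))
  (w := fun n => (quartic_int (l n * ((INR n + 0) / root4 n ^ 3)) +
   quartic_int (l n * ((INR n + 2) / root4 n ^ 3))) / l n + l n * (16 / root4 n ^ 2)).
- apply filter_imp with (2 := Hclose). intros n H. apply Rabs_le_between in H. lra.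
- replace (Finite (2 * I)) with (Finite (2 * I - 0)) by (f_equal; ring).
  apply is_lim_seq_minus'; assumption.
- replace (Finite (2 * I)) with (Finite (2 * I + 0)) by (f_equal; ring).
  apply is_lim_seq_plus'; assumption.
Qed.

(** * Comparison of the weights with the quartic exponential *)

Lemma quartic_lambda l a y : l ^ 4 = a -> quartic (l * y) = exp (- (a * y ^ 4 / 12)).
Proof. intros <-. unfold quartic. rewrite Rpow_mult_distr. reflexivity. Qed.

Lemma sqrt_sqrt_4 a : 0 <= a -> sqrt (sqrt a) ^ 4 = a.
Proof.
intros H. replace (sqrt (sqrt a) ^ 4) with ((sqrt (sqrt a) ^ 2) ^ 2) by ring.
rewrite !pow2_sqrt; [reflexivity|exact H|apply sqrt_pos].
Qed.

(** With [r = root4 n] and [x = m / r^3] the two quadratic terms add up to at most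
    [2 x^2 / r^2 <= (1 + x^4) / r^2]. The constant goes into the prefactor and the quartic part into
    [l]. *)
Lemma weight_upper_quartic n j l : (0 < n)%nat -> (j <= n)%nat ->
  l ^ 4 = 1 - 12 / root4 n ^ 2 ->
  weight n j / center n <=
    exp (1 / root4 n ^ 2) * quartic (l * (spin n j / root4 n ^ 3)).
Proof.
intros Hn Hj Hl. rewrite (quartic_lambda _ _ _ Hl), <- exp_plus.
eapply Rle_trans; [apply weight_upper; assumption|]. apply exp_le_compat.
assert (Hn1 : 1 <= INR n) by (apply (le_INR 1); lia).
rewrite <- root4_pow4.
assert (Hr := root4_pos n). assert (Hr4 := root4_pow4 n).
assert (Hr1 : 1 <= root4 n).
{ destruct (Rle_lt_dec 1 (root4 n)) as [H|H]; [exact H|exfalso].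
  assert (root4 n ^ 4 <= 1 ^ 4) by (apply pow_incr; lra). lra. }
set (r := root4 n) in *. set (x := spin n j / r ^ 3).
assert (Hr2 : 0 < r ^ 2) by (apply pow_lt, Hr).
replace (spin n j) with (x * r ^ 3) by (unfold x; field; lra).
replace ((x * r ^ 3) ^ 4 / (12 * (r ^ 4) ^ 3)) with (x ^ 4 / 12) by (field; lra).
replace ((x * r ^ 3) ^ 2 / (6 * (r ^ 4) ^ 3)) with (x ^ 2 * / r ^ 2 * (1 / 6 * / r ^ 4)) by (field; lra).
replace ((x * r ^ 3) ^ 2 / (2 * INR n * r ^ 4)) with (x ^ 2 * / r ^ 2 * (r ^ 4 / (2 * INR n)))
  by (field; lra).
assert (A1 : / r ^ 4 <= 1).
{ rewrite <- Rinv_1. apply Rinv_le_contravar; lra. }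
assert (A2 : r ^ 4 / (2 * INR n) <= 1).
{ apply Rle_div_l; lra. }
assert (A3 : 0 <= x ^ 2 * / r ^ 2).
{ apply Rmult_le_pos; [apply pow2_ge_0|left; apply Rinv_0_lt_compat, Hr2]. }
assert (A4 : 2 * (x ^ 2 * / r ^ 2) <= (1 + x ^ 4) * / r ^ 2).
{ rewrite <- Rmult_assoc. apply Rmult_le_compat_r; [left; apply Rinv_0_lt_compat, Hr2|].
  generalize (pow2_ge_0 (x ^ 2 - 1)). replace (x ^ 4) with ((x ^ 2) ^ 2) by ring. lra. }
replace ((1 - 12 / r ^ 2) * x ^ 4 / 12) with (x ^ 4 / 12 - x ^ 4 * / r ^ 2) by (field; lra).
unfold Rdiv at 4. 
nra.
Qed.

Lemma Rabs_le_pow2 a b : 0 <= b -> a ^ 2 <= b ^ 2 -> Rabs a <= b.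
Proof.
intros Hb H. rewrite <- (Rabs_pos_eq b) by exact Hb. apply Rsqr_le_abs_0. unfold Rsqr. lra.
Qed.

Lemma weight_pos n j : 0 < weight n j.
Proof. apply Rmult_lt_0_compat; [apply C_pos|apply exp_pos]. Qed.

Lemma weight_div_pos n j : 0 < weight n j / center n.
Proof. apply Rdiv_lt_0_compat; [apply weight_pos|apply center_pos]. Qed.

(** If [x^2 <= r], the loss [x^6 / 12r^2] is at most [x^4 / 12r], which [l] absorbs. If [x^2 > r],
    then [x^4 >= r^2], so the quartic exponential is itself at most [12 / r^2] and the left side is
    not positive. *)
Lemma weight_lower_quartic n j l : (0 < n)%nat -> (j <= n)%nat -> 4 <= root4 n ->
  l ^ 4 = 1 + 1 / root4 n ->
  quartic (l * (spin n j / root4 n ^ 3)) - 12 / root4 n ^ 2 <= weight n j / center n.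
Proof.
intros Hn Hj Hr Hl. rewrite (quartic_lambda _ _ _ Hl).
assert (W := weight_lower n j Hn Hj). rewrite <- root4_pow4 in W.
assert (Wp := weight_div_pos n j).
set (r := root4 n) in *. set (x := spin n j / r ^ 3).
assert (Hr2 : 0 < r ^ 2) by (apply pow_lt; lra).
assert (Hx : spin n j = x * r ^ 3) by (unfold x; field; lra).
assert (Hx4 := pow4_ge_0 x).
assert (Hir : 0 < / r) by (apply Rinv_0_lt_compat; lra).
assert (H12 : 0 < 12 / r ^ 2) by (apply Rdiv_lt_0_compat; lra).
replace ((1 + 1 / r) * x ^ 4 / 12) with (x ^ 4 / 12 + x ^ 4 * / r / 12) by (field; lra).
assert (0 <= x ^ 4 * / r) by (apply Rmult_le_pos; lra).
destruct (Rle_lt_dec (x ^ 2) r) as [Hc|Hc].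
- rewrite Hx in W.
  replace ((x * r ^ 3) ^ 4 / (12 * (r ^ 4) ^ 3)) with (x ^ 4 / 12) in W by (field; lra).
  replace ((x * r ^ 3) ^ 6 / (12 * (r ^ 4) ^ 5)) with (x ^ 4 * (x ^ 2) * / r ^ 2 / 12) in W by (field; lra).
  eapply Rle_trans; [|apply W].
  + assert (x ^ 4 * x ^ 2 * / r ^ 2 <= x ^ 4 * / r).
    { replace (x ^ 4 * / r) with (x ^ 4 * r * / r ^ 2) by (field; lra).
      apply Rmult_le_compat_r; [left; apply Rinv_0_lt_compat, Hr2|].
      apply Rmult_le_compat_l; assumption. }
    apply Rle_trans with (exp (- (x ^ 4 / 12 + x ^ 4 * / r / 12))); [lra|].
    apply exp_le_compat. lra.
  (* The condition [|m| <= N / 2] reads [x^2 r^6 <= r^8 / 4] and follows from [x^2 <= r] and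
     [r >= 4]. *)
  + apply Rabs_le_pow2; [generalize (pow_lt r 4); lra|].
    replace ((x * r ^ 3) ^ 2) with (x ^ 2 * r ^ 6) by ring.
    replace ((r ^ 4 / 2) ^ 2) with (r * (r / 4) * r ^ 6) by field.
    apply Rmult_le_compat_r; [apply pow_le; lra|]. nra.
- assert (r ^ 2 <= x ^ 4).
  { replace (x ^ 4) with ((x ^ 2) ^ 2) by ring. apply pow_incr. lra. }
  enough (exp (- (x ^ 4 / 12 + x ^ 4 * / r / 12)) <= 12 / r ^ 2) by lra.
  rewrite exp_Ropp. replace (12 / r ^ 2) with (/ (r ^ 2 / 12)) by (field; lra).
  apply Rinv_le_contravar; [lra|].
  eapply Rle_trans; [|apply exp_ineq1_le]. lra.
Qed.

Lemma partition_lim (I : R) : is_lim quartic_int p_infty I ->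
  is_lim_seq (fun n => sum_f_R0 (fun j => 2 / root4 n ^ 3 * (weight n j / center n)) n) (2 * I).
Proof.
intros HI.
set (lm := fun n => sqrt (sqrt (1 + 1 / root4 n))).
set (lp := fun n => sqrt (sqrt (1 - 12 / root4 n ^ 2))).
assert (Hlm : is_lim_seq lm 1).
{ apply is_lim_seq_sqrt_1, is_lim_seq_sqrt_1.
  replace (Finite 1) with (Finite (1 + 0)) by (f_equal; ring).
  apply is_lim_seq_plus'; [apply is_lim_seq_const|].
  apply is_lim_seq_ext with (2 := is_lim_seq_div_root4 1 0). intros n. f_equal. ring. }
assert (Hlp : is_lim_seq lp 1).
{ apply is_lim_seq_sqrt_1, is_lim_seq_sqrt_1.
  replace (Finite 1) with (Finite (1 - 0)) by (f_equal; ring).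
  apply is_lim_seq_minus'; [apply is_lim_seq_const|apply is_lim_seq_div_root4]. }
(* The threshold [4] serves the lower bound on the weights and makes [1 - 12 / root4^2] positive, so
   that its fourth root [lp] is available. *)
assert (Ev : eventually (fun n => 4 < root4 n /\ (0 < n)%nat)).
{ apply filter_and; [apply root4_eventually|]. exists 1%nat. lia. }
assert (Hlp0 : forall n, 4 < root4 n -> 0 < 1 - 12 / root4 n ^ 2).
{ intros n Hn. enough (12 / root4 n ^ 2 < 1) by lra. apply Rlt_div_l; nra. }
assert (Hlm0 : forall n, 4 < root4 n -> 0 < 1 + 1 / root4 n).
{ intros n Hn. enough (0 < 1 / root4 n) by lra. apply Rdiv_lt_0_compat; lra. }
apply is_lim_seq_le_le_loc with
  (u := fun n => sum_f_R0 (fun j => 2 / root4 n ^ 3 * quartic (lm n * (spin n j / root4 n ^ 3))) n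
                 - 24 / root4 n ^ 1)
  (w := fun n => exp (1 / root4 n ^ 2) *
           sum_f_R0 (fun j => 2 / root4 n ^ 3 * quartic (lp n * (spin n j / root4 n ^ 3))) n).
- apply filter_imp with (2 := Ev). intros n [Hr Hn].
  assert (Hr3 : 0 < root4 n ^ 3) by (apply pow_lt; lra).
  assert (Hh : 0 < 2 / root4 n ^ 3) by (apply Rdiv_lt_0_compat; lra).
  split.
  (* The additive error [12 / root4^2] times the mesh [2 / root4^3], summed over [N = root4^4]
     spins, is [24 / root4]. *)
  + replace (24 / root4 n ^ 1) with (sum_f_R0 (fun _ => 24 / root4 n ^ 5) n).
    2:{ rewrite sum_cte, S_INR, <- root4_pow4. field. lra. }
    rewrite <- minus_sum. apply sum_Rle. intros j Hj.
    replace (24 / root4 n ^ 5) with (2 / root4 n ^ 3 * (12 / root4 n ^ 2)) by (field; lra).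
    rewrite <- Rmult_minus_distr_l. apply Rmult_le_compat_l; [lra|].
    apply weight_lower_quartic; [exact Hn|exact Hj|lra|].
    apply sqrt_sqrt_4. left. apply Hlm0, Hr.
  + rewrite scal_sum. apply sum_Rle. intros j Hj.
    rewrite Rmult_assoc. apply Rmult_le_compat_l; [lra|]. rewrite Rmult_comm.
    apply weight_upper_quartic; [exact Hn|exact Hj|].
    apply sqrt_sqrt_4. left. apply Hlp0, Hr.
- replace (Finite (2 * I)) with (Finite (2 * I - 0)) by (f_equal; ring).
  apply is_lim_seq_minus'; [|apply is_lim_seq_div_root4].
  apply quartic_sum_lim; [exact HI|exact Hlm|].
  apply filter_imp with (2 := Ev). intros n [Hr _].
  apply sqrt_lt_R0, sqrt_lt_R0, Hlm0, Hr.
- replace (Finite (2 * I)) with (Finite (exp 0 * (2 * I))) by (rewrite exp_0; f_equal; ring).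
  apply is_lim_seq_mult'; [apply is_lim_seq_exp, is_lim_seq_div_root4|].
  apply quartic_sum_lim; [exact HI|exact Hlp|].
  apply filter_imp with (2 := Ev). intros n [Hr _].
  apply sqrt_lt_R0, sqrt_lt_R0, Hlp0, Hr.
Qed.

(** * Counting grid points *)

(** A [family] is indexed by reals, so [U k] is placed at the index [INR k]; a finite list of such
    indices is bounded. *)
Lemma compact_seq_cover (A : R -> Prop) (U : nat -> R -> Prop) :
  compact A -> (forall k, open_set (U k)) -> (forall x, A x -> exists k, U k x) ->
  exists N, forall x, A x -> exists k, (k <= N)%nat /\ U k x.
Proof.
intros HA HU Hcov.
set (ff := fun y x => exists k, y = INR k /\ U k x).
assert (cond : forall y, (exists x, ff y x) -> (fun y => exists k, y = INR k) y).
{ intros y [x [k [E _]]]. exists k. exact E. }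
destruct (HA (mkfamily _ ff cond)) as [D [HD [l Hl]]].
- split.
  + intros x Hx. destruct (Hcov x Hx) as [k Hk]. exists (INR k). exists k. easy.
  + intros y x [k [E Hx]]. simpl.
    destruct (HU k x Hx) as [d Hd]. exists d. intros z Hz. exists k. split; [exact E|].
    apply Hd, Hz.
- simpl in *. unfold intersection_domain in Hl.
  assert (Hmax : exists N, forall k, In (INR k) l -> (k <= N)%nat).
  { clear. induction l as [|a l [N IH]].
    - exists 0%nat. easy.
    - destruct (INR_unbounded a) as [m Hm]. exists (Nat.max N m).
      intros k [->|Hk]; [|specialize (IH k Hk); lia].
      apply INR_lt in Hm. lia. }
  destruct Hmax as [N HN]. exists N. intros x Hx.
  destruct (HD x Hx) as [y [[k [E Hk]] Hy]]. exists k. split; [|exact Hk].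
  apply HN. rewrite <- E. apply Hl. split; [exists k; exact E|exact Hy].
Qed.

Lemma indicator_in B x : B x -> indicator B x = 1.
Proof. intros H. unfold indicator. destruct excluded_middle_informative; easy. Qed.

Lemma indicator_out B x : ~ B x -> indicator B x = 0.
Proof. intros H. unfold indicator. destruct excluded_middle_informative; easy. Qed.

Lemma indicator_ge_0 B x : 0 <= indicator B x.
Proof. unfold indicator. destruct excluded_middle_informative; lra. Qed.

Lemma count_interval a b x h n : a <= b -> 0 < h ->
  h * sum_f_R0 (fun j => indicator (fun y => a < y < b) (x - INR j * h)) n <= b - a + h.
Proof.
intros Hab Hh.
(* Each counted point [y] claims the cell from [y] to [y + h]; the claimed cells do not overlap and
   lie between [max a (x - n h)] and [b + h]. *)
assert (H : forall n, h * sum_f_R0 (fun j => indicator (fun y => a < y < b) (x - INR j * h)) n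
   <= Rmax 0 (b + h - Rmax a (x - INR n * h))).
{ clear n. induction n as [|n IH].
  - simpl. rewrite Rmult_0_l, Rminus_0_r. unfold indicator.
    unfold Rmax. repeat destruct Rle_dec; destruct excluded_middle_informative; lra.
  - rewrite tech5, Rmult_plus_distr_l, S_INR.
    set (y := x - INR n * h) in *.
    replace (x - (INR n + 1) * h) with (y - h) by (unfold y; ring).
    set (s := h * sum_f_R0 (fun j : nat => indicator (fun y => a < y < b) (x - INR j * h)) n) in *.
    unfold indicator, Rmax in *.
    repeat destruct Rle_dec; destruct excluded_middle_informative; lra. }
eapply Rle_trans; [apply H|].
unfold Rmax. repeat destruct Rle_dec; lra.
Qed.

(** The supremum [z] of the part of [B] in [[y, x]] is adherent to [B]. Were it interior, then
    [z < x], and points of [B] just above [z] would contradict the supremum. *)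
Lemma boundary_crossing (B : R -> Prop) y x :
  y <= x -> B y -> ~ B x -> exists z, y <= z <= x /\ boundary B z.
Proof.
intros Hyx Hy Hx.
destruct (completeness (fun t => y <= t <= x /\ B t)) as [z [Hub Hlub]].
- exists x. intros t [Ht _]. apply Ht.
- exists y. split; [lra|exact Hy].
- assert (Hzy : y <= z) by (apply Hub; split; [lra|exact Hy]).
  assert (Hzx : z <= x) by (apply Hlub; intros t [Ht _]; apply Ht).
  exists z. split; [lra|]. split.
  + intros V [d Hd]. destruct (classic (exists t, B t /\ y <= t <= x /\ z - d < t)) as [[t [Bt [Ht1 Ht2]]]|H].
    * exists t. split; [|exact Bt]. apply Hd. unfold disc.
      assert (t <= z) by (apply Hub; split; assumption). apply Rabs_def1; generalize (cond_pos d); lra.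
    * exfalso. assert (z <= z - d); [|generalize (cond_pos d); lra].
      apply Hlub. intros t [Ht Bt]. destruct (Rle_lt_dec t (z - d)) as [L|L]; [exact L|].
      exfalso. apply H. exists t. easy.
  + intros Hint. assert (Bz := interior_P1 B z Hint).
    destruct Hint as [d Hd].
    assert (z < x) by (destruct Hzx as [L|L]; [exact L|subst; easy]).
    set (t := z + Rmin (d / 2) (x - z)).
    assert (Ht : z < t <= x /\ t - z < d).
    { generalize (cond_pos d). unfold t, Rmin. destruct Rle_dec; lra. }
    assert (t <= z); [|lra].
    apply Hub. split; [lra|]. apply Hd. unfold disc. apply Rabs_def1; lra.
Qed.

(** Compactness is applied to the closure, covered by the intervals each enlarged by the interior of
    [B]. Boundary points avoid the interior, so finitely many intervals catch them. *)
Lemma finite_boundary_cover (B : R -> Prop) eps :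
  relatively_compact B -> lebesgue_null (boundary B) -> 0 < eps ->
  exists a b N, (forall k, a k <= b k) /\ sum_f_R0 (fun k => b k - a k) N < eps /\
    forall x, boundary B x -> exists k, (k <= N)%nat /\ a k < x < b k.
Proof.
intros HB Hnull Heps.
destruct (Hnull eps Heps) as [a [b [[Hab Hcov] Hs]]].
destruct (compact_seq_cover (adherence B) (fun k x => a k < x < b k \/ interior B x)) as [N HN].
- exact HB.
- intros k x [H|H].
  + assert (Hd : 0 < Rmin (x - a k) (b k - x)) by (apply Rmin_pos; lra).
    exists (mkposreal _ Hd). intros z Hz. left. unfold disc in Hz. simpl in Hz.
    apply Rabs_def2 in Hz. revert Hz. unfold Rmin. destruct Rle_dec; lra.
  + destruct (interior_P3 B x H) as [d Hd]. exists d. intros z Hz. right. apply Hd, Hz.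
- intros x Hx. destruct (classic (interior B x)) as [H|H].
  + exists 0%nat. right. exact H.
  + destruct (Hcov x (conj Hx H)) as [k Hk]. exists k. left. exact Hk.
- exists a, b, N. split; [exact Hab|]. split; [apply Hs|].
  intros x [Hx Hi]. destruct (HN x Hx) as [k [Hk [H|H]]]; [|easy]. exists k. easy.
Qed.

Lemma sum_f_R0_swap (F : nat -> nat -> R) n m :
  sum_f_R0 (fun i => sum_f_R0 (fun j => F i j) m) n =
  sum_f_R0 (fun j => sum_f_R0 (fun i => F i j) n) m.
Proof.
induction n as [|n IH]; [reflexivity|]. rewrite tech5, IH, <- plus_sum. reflexivity.
Qed.

Lemma sum_f_R0_ge_term (u : nat -> R) k n :
  (forall i, 0 <= u i) -> (k <= n)%nat -> u k <= sum_f_R0 u n.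
Proof.
intros Hu. induction n as [|n IH]; intros H.
- replace k with 0%nat by lia. right. reflexivity.
- rewrite tech5. destruct (Nat.eq_dec k (S n)) as [->|Hk].
  + generalize (cond_pos_sum u n Hu). lra.
  + generalize (IH ltac:(lia)) (Hu (S n)). lra.
Qed.

Lemma count_cover (B : R -> Prop) (a b : nat -> R) N h x n : 0 < h ->
  (forall k, a k <= b k) ->
  (forall y, B y -> exists k, (k <= N)%nat /\ a k < y < b k) ->
  h * sum_f_R0 (fun j => indicator B (x - INR j * h)) n <=
  sum_f_R0 (fun k => b k - a k) N + INR (S N) * h.
Proof.
intros Hh Hab Hcov.
apply Rle_trans with (h * sum_f_R0 (fun j => sum_f_R0 (fun k =>
  indicator (fun y => a k < y < b k) (x - INR j * h)) N) n).
- apply Rmult_le_compat_l; [lra|]. apply sum_Rle. intros j _.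
  set (y := x - INR j * h).
  assert (Hpos : forall k, 0 <= indicator (fun t => a k < t < b k) y)
    by (intros; apply indicator_ge_0).
  destruct (classic (B y)) as [H|H].
  + destruct (Hcov y H) as [k [Hk Hy]].
    rewrite indicator_in by exact H.
    rewrite <- (indicator_in (fun t => a k < t < b k) y Hy).
    apply (sum_f_R0_ge_term (fun k => indicator (fun t => a k < t < b k) y)); assumption.
  + rewrite indicator_out by exact H. apply cond_pos_sum, Hpos.
- rewrite sum_f_R0_swap, scal_sum.
  replace (INR (S N) * h) with (sum_f_R0 (fun _ => h) N) by (rewrite sum_cte; ring).
  rewrite <- plus_sum. apply sum_Rle. intros k _. rewrite Rmult_comm.
  apply count_interval; [apply Hab|exact Hh].
Qed.

(** A nearly optimal cover of [B] may miss points of its closure, so the small finite cover of the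
    boundary is added; compactness then leaves finitely many intervals, each costing at most one
    extra mesh. *)
Lemma count_upper (B : R -> Prop) mB eps :
  relatively_compact B -> lebesgue_null (boundary B) -> lebesgue_measure_is B mB -> 0 < eps ->
  exists N, forall h x n, 0 < h ->
    h * sum_f_R0 (fun j => indicator B (x - INR j * h)) n <= mB + eps + INR N * h.
Proof.
intros HB Hnull [Hlow Hglb] Heps.
destruct (finite_boundary_cover B (eps / 2) HB Hnull ltac:(lra)) as [a [b [N1 [Hab [Hs Hcov]]]]].
assert (Hex : exists s, s < mB + eps / 2 /\ exists a b, interval_cover B a b /\
          infinite_sum (fun k => b k - a k) s).
{ destruct (classic (exists s, s < mB + eps / 2 /\ exists a b, interval_cover B a b /\
          infinite_sum (fun k => b k - a k) s)) as [H|H]; [exact H|exfalso].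
  assert (mB + eps / 2 <= mB); [|lra]. apply Hglb. intros s Hs'.
  destruct (Rle_lt_dec (mB + eps / 2) s) as [L|L]; [exact L|exfalso].
  apply H. exists s. easy. }
destruct Hex as [s [Hsm [a' [b' [[Hab' Hcov'] Hs']]]]].
destruct (compact_seq_cover (adherence B) (fun k y => a' k < y < b' k \/
   exists i, (i <= N1)%nat /\ a i < y < b i)) as [N2 HN].
- exact HB.
- assert (Hop : forall c d y, c < y < d -> exists e : posreal, forall z, disc y e z -> c < z < d).
  { intros c d y H. assert (Hd : 0 < Rmin (y - c) (d - y)) by (apply Rmin_pos; lra).
    exists (mkposreal _ Hd). intros z Hz. unfold disc in Hz. simpl in Hz.
    apply Rabs_def2 in Hz. revert Hz. unfold Rmin. destruct Rle_dec; lra. }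
  intros k y [H|[i [Hi H]]]; destruct (Hop _ _ _ H) as [e He]; exists e; intros z Hz.
  + left. apply He, Hz.
  + right. exists i. split; [exact Hi|]. apply He, Hz.
- intros y Hy. destruct (classic (interior B y)) as [H|H].
  + destruct (Hcov' y (interior_P1 B y H)) as [k Hk]. exists k. left. exact Hk.
  + destruct (Hcov y (conj Hy H)) as [i Hi]. exists 0%nat. right. exists i. exact Hi.
- exists (S N1 + S N2)%nat. intros h x n Hh.
  (* Indices up to [N1] hold the boundary cover, the following [N2 + 1] the cover of [B]. *)
  set (c := fun k => if le_lt_dec k N1 then a k else a' (k - S N1)%nat).
  set (d := fun k => if le_lt_dec k N1 then b k else b' (k - S N1)%nat).
  eapply Rle_trans; [apply (count_cover B c d (S N1 + N2) h x n Hh)|].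
  + intros k. unfold c, d. destruct le_lt_dec; [apply Hab|apply Hab'].
  + intros y Hy. destruct (HN y (adherence_P1 B y Hy)) as [k [Hk [H|[i [Hi H]]]]].
    * exists (S N1 + k)%nat. split; [lia|]. unfold c, d.
      destruct le_lt_dec; [lia|]. replace (S N1 + k - S N1)%nat with k by lia. exact H.
    * exists i. split; [lia|]. unfold c, d. destruct le_lt_dec; [exact H|lia].
  + rewrite (tech2 _ N1 (S N1 + N2)) by lia.
    replace (S N1 + N2 - S N1)%nat with N2 by lia.
    rewrite (sum_eq (fun k => d k - c k) (fun k => b k - a k) N1).
    2:{ intros k Hk. unfold c, d. destruct le_lt_dec; [reflexivity|lia]. }
    rewrite (sum_eq (fun k => d (S N1 + k)%nat - c (S N1 + k)%nat) (fun k => b' k - a' k) N2).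
    2:{ intros k Hk. unfold c, d. destruct le_lt_dec; [lia|].
        replace (S N1 + k - S N1)%nat with k by lia. reflexivity. }
    assert (sum_f_R0 (fun k => b' k - a' k) N2 <= s).
    { apply sum_incr; [exact Hs'|]. intros k. specialize (Hab' k). lra. }
    replace (S (S N1 + N2)) with (S N1 + S N2)%nat by lia. lra.
Qed.

(* Every point of [B] lies in a cell of the grid whose right end is in [B],
   or else the cell contains a boundary point. *)
Lemma count_lower (B : R -> Prop) mB eps :
  relatively_compact B -> lebesgue_null (boundary B) -> lebesgue_measure_is B mB -> 0 < eps ->
  exists N, forall h x n, 0 < h ->
    (forall y, B y -> exists j, (j <= n)%nat /\ x - INR j * h - h < y <= x - INR j * h) ->
    mB <= h * sum_f_R0 (fun j => indicator B (x - INR j * h)) n + eps + INR N * h.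
Proof.
intros HB Hnull [Hlow _] Heps.
destruct (finite_boundary_cover B eps HB Hnull Heps) as [a [b [N [Hab [Hs Hcov]]]]].
exists (2 * S N)%nat. intros h x n Hh Hgrid.
set (cnt := sum_f_R0 (fun j => indicator B (x - INR j * h)) n).
assert (Hcnt : 0 <= cnt <= INR (S n)).
{ split; [apply cond_pos_sum; intros; apply indicator_ge_0|].
  rewrite <- (Rmult_1_l (INR (S n))), <- sum_cte. apply sum_Rle. intros j _.
  unfold indicator. destruct excluded_middle_informative; lra. }
(* Covers consist of open intervals, so each half-open cell is extended by [eta h] to contain its
   right end; a small [eta] is chosen at the end. *)
assert (Heta : forall eta, 0 < eta -> mB <= (1 + eta) * (h * cnt) + (eps + INR (2 * S N) * h)).
{ intros eta Heta.
  set (p := fun j => x - INR j * h).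
  set (len := fun j => (1 + eta) * h * indicator B (p j)).
  (* First come the boundary intervals widened by [h], as a boundary point in a cell is within [h]
     of the point [y] to be covered; then the cells with right end in [B]. All other intervals are
     the empty [(0, 0)]. *)
  set (c := fun k => if le_lt_dec k N then a k - h else
     if le_lt_dec k (S N + n) then
       if excluded_middle_informative (B (p (k - S N)%nat)) then p (k - S N)%nat - h else 0
     else 0).
  set (d := fun k => if le_lt_dec k N then b k + h else
     if le_lt_dec k (S N + n) then
       if excluded_middle_informative (B (p (k - S N)%nat)) then p (k - S N)%nat + eta * h else 0
     else 0).
  assert (Hetah : 0 < eta * h) by (apply Rmult_lt_0_compat; assumption).
  apply Rle_trans with (sum_f_R0 (fun k => d k - c k) (S N + n)).
  - apply Hlow. exists c, d. split; [split|].
    + intros k. unfold c, d. specialize (Hab k). repeat destruct le_lt_dec;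
        try destruct excluded_middle_informative; lra.
    + intros y Hy. destruct (Hgrid y Hy) as [j [Hj Hyj]]. fold (p j) in Hyj.
      destruct (classic (B (p j))) as [Hp|Hp].
      * exists (S N + j)%nat. unfold c, d. destruct le_lt_dec; [lia|].
        destruct le_lt_dec; [|lia]. replace (S N + j - S N)%nat with j by lia.
        destruct excluded_middle_informative; [lra|easy].
      * destruct (boundary_crossing B y (p j)) as [z [Hz Hbz]]; [lra|exact Hy|exact Hp|].
        destruct (Hcov z Hbz) as [k [Hk Hzk]]. exists k. unfold c, d.
        destruct le_lt_dec; [lra|lia].
    + intros e He. exists (S N + n)%nat. intros m Hm.
      replace (sum_f_R0 (fun k => d k - c k) m) with (sum_f_R0 (fun k => d k - c k) (S N + n)).
      { rewrite Rdist_eq. exact He. }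
      destruct (Nat.eq_dec m (S N + n)) as [->|Hne]; [reflexivity|].
      rewrite (tech2 _ (S N + n) m) by lia.
      rewrite (sum_eq _ (fun _ => 0) (m - S (S N + n))).
      2:{ intros i _. unfold c, d. destruct le_lt_dec; [lia|]. destruct le_lt_dec; [lia|ring]. }
      rewrite sum_cte. ring.
  - rewrite (tech2 _ N (S N + n)) by lia.
    replace (S N + n - S N)%nat with n by lia.
    rewrite (sum_eq (fun k => d k - c k) (fun k => (b k - a k) + 2 * h) N).
    2:{ intros k Hk. unfold c, d. destruct le_lt_dec; [ring|lia]. }
    rewrite (sum_eq (fun k => d (S N + k)%nat - c (S N + k)%nat)
               (fun k => indicator B (p k) * ((1 + eta) * h)) n).
    2:{ intros k Hk. unfold c, d, indicator. destruct le_lt_dec; [lia|].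
        destruct le_lt_dec; [|lia]. replace (S N + k - S N)%nat with k by lia.
        destruct excluded_middle_informative; ring. }
    rewrite <- scal_sum, plus_sum, sum_cte. fold cnt.
    change (sum_f_R0 (fun k => indicator B (p k)) n) with cnt.
    rewrite mult_INR. simpl (INR 2). lra. }
apply Rnot_lt_le. intros Hlt.
set (gap := mB - (h * cnt + eps + INR (2 * S N) * h)).
assert (Hq : 0 <= h * cnt) by (apply Rmult_le_pos; lra).
assert (Hgap : 0 < gap) by (unfold gap; lra).
(* This [eta] makes the excess [eta h cnt] at most half of the gap; the [+ 1] guards against an
   empty count. *)
specialize (Heta (gap / 2 / (h * cnt + 1)) ltac:(apply Rdiv_lt_0_compat; lra)).
assert (gap / 2 / (h * cnt + 1) * (h * cnt) <= gap / 2).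
{ replace (gap / 2 / (h * cnt + 1) * (h * cnt)) with (gap / 2 * (h * cnt / (h * cnt + 1))) by (field; lra).
  rewrite <- (Rmult_1_r (gap / 2)) at 2. apply Rmult_le_compat_l; [lra|].
  apply Rle_div_l; lra. }
unfold gap in *. lra.
Qed.

(** * The limit *)

Definition rootn (n : nat) : R := Rpower (INR n) (1 / 4).

Lemma rootn_pos n : 0 < rootn n.
Proof. apply exp_pos. Qed.

Lemma rootn_pow4 n : (0 < n)%nat -> rootn n ^ 4 = INR n.
Proof. intros H. apply Rpower_quarter_4. apply (lt_INR 0), H. Qed.

Lemma Rpower_opp_quarter n : Rpower (INR n) (- (1 / 4)) = / rootn n.
Proof. apply Rpower_Ropp. Qed.

Lemma is_lim_seq_rootn : is_lim_seq rootn p_infty.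
Proof.
apply is_lim_seq_incr_1. apply is_lim_seq_ext with (2 := is_lim_seq_root4).
intros n. unfold rootn. rewrite S_INR. reflexivity.
Qed.

Lemma rootn_eventually M : eventually (fun n => (0 < n)%nat /\ M < rootn n).
Proof.
apply filter_and; [exists 1%nat; lia|].
exact (proj2 (is_lim_seq_spec _ _) is_lim_seq_rootn M).
Qed.

Lemma is_lim_seq_inv_p_infty c u : is_lim_seq u p_infty -> is_lim_seq (fun n => c / u n) 0.
Proof.
intros H. replace (Finite 0) with (Rbar_mult c (Rbar_inv p_infty)) by (simpl; f_equal; ring).
apply is_lim_seq_scal_l, is_lim_seq_inv; easy.
Qed.

Lemma rootn_root4_lim : is_lim_seq (fun n => rootn n / root4 n) 1.
Proof.
apply is_lim_seq_ext_loc with (fun n => sqrt (sqrt (1 - 1 / root4 n ^ 4))).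
- exists 1%nat. intros n Hn. assert (Hr := root4_pos n). assert (Hq := rootn_pos n).
  assert (0 <= rootn n / root4 n) by (apply Rdiv_le_0_compat; lra).
  replace (1 - 1 / root4 n ^ 4) with (((rootn n / root4 n) ^ 2) ^ 2).
  + rewrite !sqrt_pow2; [reflexivity|assumption|apply pow2_ge_0].
  + transitivity (rootn n ^ 4 / root4 n ^ 4); [field; lra|].
    rewrite rootn_pow4, root4_pow4 by lia. field. generalize (pos_INR n). lra.
- apply is_lim_seq_sqrt_1, is_lim_seq_sqrt_1.
  replace (Finite 1) with (Finite (1 - 0)) by (f_equal; ring).
  apply is_lim_seq_minus'; [apply is_lim_seq_const|apply is_lim_seq_div_root4].
Qed.

Lemma count_lim (B : R -> Prop) mB :
  relatively_compact B -> lebesgue_null (boundary B) -> lebesgue_measure_is B mB ->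
  is_lim_seq (fun n => 2 / rootn n *
    sum_f_R0 (fun j => indicator B (/ rootn n * spin n j)) n) mB.
Proof.
intros HB Hnull HmB. apply is_lim_seq_spec. intros eps. assert (Heps := cond_pos eps).
destruct (count_upper B mB (eps / 2) HB Hnull HmB ltac:(lra)) as [N1 H1].
destruct (count_lower B mB (eps / 2) HB Hnull HmB ltac:(lra)) as [N2 H2].
destruct (compact_P1 _ HB) as [k1 [k2 Hbd]].
(* For [q > M] the grid, which reaches from [- q^3] to [q^3], surrounds [B] since [q <= q^3], and
   the mesh errors [N1 * 2 / q] and [N2 * 2 / q] are below [eps / 2]. *)
set (M := 1 + Rabs k1 + Rabs k2 + INR N1 * 4 / eps + INR N2 * 4 / eps).
apply filter_imp with (2 := rootn_eventually M). intros n [Hn HM].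
assert (Hq := rootn_pos n). assert (Hq4 := rootn_pow4 n Hn). set (q := rootn n) in *.
assert (P1 := Rabs_pos k1). assert (P2 := Rabs_pos k2).
assert (P3 : forall N, 0 <= INR N * 4 / eps).
{ intros N. apply Rdiv_le_0_compat; [generalize (pos_INR N); lra|lra]. }
assert (Hq1 : 1 < q) by (generalize (P3 N1) (P3 N2); unfold M in HM; lra).
assert (Hh : 0 < 2 / q) by (apply Rdiv_lt_0_compat; lra).
assert (HN : forall N, INR N * 4 / eps < q -> INR N * (2 / q) < eps / 2).
{ intros N H. apply Rlt_div_l in H; [|lra].
  replace (INR N * (2 / q)) with (INR N * 2 / q) by (field; lra). apply Rlt_div_l; lra. }
assert (HN1 := HN N1 ltac:(generalize (P3 N2); unfold M in HM; lra)).
assert (HN2 := HN N2 ltac:(generalize (P3 N1); unfold M in HM; lra)).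
assert (Hgrid : forall j, INR n / q - INR j * (2 / q) = / q * spin n j).
{ intros j. unfold spin. field. lra. }
specialize (H1 (2 / q) (INR n / q) n Hh).
specialize (H2 (2 / q) (INR n / q) n Hh).
rewrite (sum_eq _ (fun j => indicator B (/ q * spin n j))) in H1, H2
  by (intros j _; rewrite Hgrid; reflexivity).
assert (mB <= 2 / q * sum_f_R0 (fun j => indicator B (/ q * spin n j)) n + eps / 2 + INR N2 * (2 / q)).
{ apply H2. intros y Hy. assert (Hyk := Hbd y (adherence_P1 B y Hy)).
  assert (Hq3 : q <= q ^ 3) by (rewrite <- (pow_1 q) at 1; apply Rle_pow; [lra|lia]).
  assert (Hyq : - q ^ 3 < y < q ^ 3).
  { assert (- Rabs k1 <= k1) by (generalize (Rle_abs (- k1)); rewrite Rabs_Ropp; lra).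
    generalize (Rle_abs k2) (P3 N1) (P3 N2). unfold M in HM. lra. }
  assert (Ex0 : INR n / q = q ^ 3) by (rewrite <- Hq4; field; lra).
  rewrite Ex0.
  (* [j] counts the whole meshes between [y] and the top [q^3]; [y > - q^3] keeps [j] at most
     [n]. *)
  destruct (nfloor_ex ((q ^ 3 - y) / (2 / q))) as [j [Hj1 Hj2]].
  { apply Rdiv_le_0_compat; lra. }
  apply Rle_div_r in Hj1; [|lra]. apply Rlt_div_l in Hj2; [|lra].
  exists j. split; [|lra].
  apply Nat.lt_succ_r, INR_lt. rewrite S_INR.
  apply Rmult_lt_reg_r with (2 / q); [exact Hh|].
  replace ((INR n + 1) * (2 / q)) with (2 * q ^ 3 + 2 / q) by (rewrite <- Hq4; field; lra).
  lra. }
apply Rabs_def1; lra.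
Qed.

(** For [m = O(n^(1/4))] every correction in the exponent is [O(1/n)]. The condition [16 K^4 <= n]
    gives [m^4 <= n^2 / 16], hence the bound [|m| <= N / 2] for [weight_lower]. *)
Lemma weight_local n j K : (0 < n)%nat -> (j <= n)%nat -> 0 <= K ->
  16 * K ^ 4 <= INR n -> spin n j ^ 4 <= K ^ 4 * INR n ->
  exp (- ((K ^ 4 + K ^ 6) / INR n)) <= weight n j / center n <= exp (K ^ 2 / INR n).
Proof.
intros Hn Hj HK HnK Hs.
assert (Hn1 : 1 <= INR n) by (apply (le_INR 1); lia).
set (m := spin n j) in *. set (x := INR n) in *.
assert (HK2 := pow2_ge_0 K). assert (Hm2 := pow2_ge_0 m).
assert (HK4 := pow4_ge_0 K). assert (Hm4 := pow4_ge_0 m).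
assert (Hx2 : x <= x ^ 2) by nra.
assert (Hs2 : m ^ 2 <= K ^ 2 * x).
{ rewrite <- (Rabs_pos_eq (m ^ 2)) by exact Hm2. apply Rabs_le_pow2; [nra|].
  replace ((m ^ 2) ^ 2) with (m ^ 4) by ring. replace ((K ^ 2 * x) ^ 2) with (K ^ 4 * x ^ 2) by ring.
  eapply Rle_trans; [exact Hs|]. apply Rmult_le_compat_l; assumption. }
assert (Hfrac : forall a b c : R, 0 < b -> a * x <= c * b -> a / b <= c / x).
{ intros a b c Hb H. apply Rle_div_l; [exact Hb|].
  replace (c / x * b) with (c * b / x) by (field; lra). apply Rle_div_r; lra. }
assert (Hm0 : 0 <= K ^ 2 * x) by nra.
assert (Hx3 : x ^ 2 <= (x + 1) ^ 3).
{ replace ((x + 1) ^ 3) with (x ^ 3 + 3 * x ^ 2 + 3 * x + 1) by ring.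
  assert (0 <= x ^ 3) by (apply pow_le; lra). lra. }
split.
- eapply Rle_trans; [|apply weight_lower; [exact Hn|exact Hj|]]; fold m x.
  + apply exp_le_compat.
    assert (E1 : m ^ 4 / (12 * (x + 1) ^ 3) <= K ^ 4 / x).
    { apply Hfrac; [lra|].
      apply Rle_trans with (K ^ 4 * x * x); [nra|].
      rewrite Rmult_assoc. apply Rmult_le_compat_l; [assumption|]. lra. }
    assert (E2 : m ^ 6 / (12 * (x + 1) ^ 5) <= K ^ 6 / x).
    { assert (Hx5 : x ^ 3 <= (x + 1) ^ 5).
      { apply Rle_trans with (x ^ 5); [apply Rle_pow; [lra|lia]|apply pow_incr; lra]. }
      assert (0 < (x + 1) ^ 5) by (apply pow_lt; lra).
      apply Hfrac; [lra|].
      apply Rle_trans with (K ^ 6 * x ^ 3).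
      - replace (m ^ 6 * x) with (m ^ 4 * m ^ 2 * x) by ring.
        replace (K ^ 6 * x ^ 3) with (K ^ 4 * x * (K ^ 2 * x) * x) by ring.
        apply Rmult_le_compat_r; [lra|]. apply Rmult_le_compat; assumption.
      - apply Rmult_le_compat_l; [apply pow_le; assumption|]. lra. }
    unfold Rdiv in *. lra.
  + apply Rabs_le_pow2; [lra|].
    rewrite <- (Rabs_pos_eq (m ^ 2)) by exact Hm2. apply Rabs_le_pow2; [apply pow2_ge_0|].
    replace ((m ^ 2) ^ 2) with (m ^ 4) by ring.
    replace ((((x + 1) / 2) ^ 2) ^ 2) with ((x + 1) ^ 3 * (x + 1) / 16) by field.
    assert (K ^ 4 * x <= x / 16 * x) by (apply Rmult_le_compat_r; lra).
    assert (x ^ 2 * 1 <= (x + 1) ^ 3 * (x + 1)) by (apply Rmult_le_compat; lra).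
    lra.
- eapply Rle_trans; [apply weight_upper; assumption|]; fold m x. apply exp_le_compat.
  assert (E1 : m ^ 2 / (6 * (x + 1) ^ 3) <= (K ^ 2 / 2) / x).
  { apply Hfrac; [lra|]. apply Rle_trans with (K ^ 2 * x * x); [apply Rmult_le_compat_r; lra|].
    replace (K ^ 2 * x * x) with (K ^ 2 * x ^ 2) by ring.
    replace (K ^ 2 / 2 * (6 * (x + 1) ^ 3)) with (K ^ 2 * (3 * (x + 1) ^ 3)) by field.
    apply Rmult_le_compat_l; lra. }
  assert (E2 : m ^ 2 / (2 * x * (x + 1)) <= (K ^ 2 / 2) / x).
  { apply Hfrac; [nra|]. apply Rle_trans with (K ^ 2 * x * x); [apply Rmult_le_compat_r; lra|].
    nra. }
  assert (0 <= m ^ 4 / (12 * (x + 1) ^ 3)) by (apply Rdiv_le_0_compat; lra).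
  replace (K ^ 2 / x) with (K ^ 2 / 2 / x + K ^ 2 / 2 / x) by (field; lra).
  lra.
Qed.

(** As [B] lies in some [[-K, K]], only spins with [|m| <= K n^(1/4)] count. Their weights relative
    to [center] are uniformly close to [1], which reduces the sum to [count_lim]. *)
Lemma numerator_lim (B : R -> Prop) mB :
  relatively_compact B -> lebesgue_null (boundary B) -> lebesgue_measure_is B mB ->
  is_lim_seq (fun n => 2 / rootn n *
    sum_f_R0 (fun j => weight n j / center n * indicator B (/ rootn n * spin n j)) n) mB.
Proof.
intros HB Hnull HmB.
assert (Hcnt := count_lim B mB HB Hnull HmB).
destruct (compact_P1 _ HB) as [k1 [k2 Hbd]].
set (K := Rabs k1 + Rabs k2).
assert (HK : 0 <= K) by (generalize (Rabs_pos k1) (Rabs_pos k2); unfold K; lra).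
assert (HBK : forall y, B y -> Rabs y <= K).
{ intros y Hy. specialize (Hbd y (adherence_P1 B y Hy)). unfold K.
  generalize (Rle_abs k2) (Rle_abs (- k1)) (Rabs_pos k1) (Rabs_pos k2).
  rewrite Rabs_Ropp. intros. apply Rabs_le. lra. }
set (cnt := fun n => 2 / rootn n * sum_f_R0 (fun j => indicator B (/ rootn n * spin n j)) n) in *.
assert (Hexp : forall c, is_lim_seq (fun n => exp (c / INR n) * cnt n) mB).
{ intros c. replace (Finite mB) with (Finite (exp 0 * mB)) by (rewrite exp_0; f_equal; ring).
  apply is_lim_seq_mult'; [|exact Hcnt].
  apply is_lim_seq_exp, is_lim_seq_inv_p_infty, is_lim_seq_INR. }
apply is_lim_seq_le_le_loc with (u := fun n => exp ((- (K ^ 4 + K ^ 6)) / INR n) * cnt n)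
  (w := fun n => exp (K ^ 2 / INR n) * cnt n); [|apply Hexp|apply Hexp].
assert (Ev : eventually (fun n => (0 < n)%nat /\ 16 * K ^ 4 <= INR n)).
{ apply filter_and; [exists 1%nat; lia|].
  destruct (INR_unbounded (16 * K ^ 4)) as [n0 H0]. exists n0. intros n Hn.
  apply le_INR in Hn. lra. }
apply filter_imp with (2 := Ev). intros n [Hn HnK].
assert (Hq := rootn_pos n). assert (Hq4 := rootn_pow4 n Hn).
assert (Hn0 : 0 < INR n) by (apply (lt_INR 0), Hn).
assert (Hh : 0 <= 2 / rootn n) by (apply Rdiv_le_0_compat; lra).
assert (Hw : forall j, (j <= n)%nat ->
  let ind := indicator B (/ rootn n * spin n j) in
  ind * exp (- ((K ^ 4 + K ^ 6) / INR n)) <= weight n j / center n * ind <=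
  ind * exp (K ^ 2 / INR n)).
{ intros j Hj ind. unfold ind.
  destruct (classic (B (/ rootn n * spin n j))) as [Hb|Hb].
  - rewrite indicator_in by exact Hb. rewrite !Rmult_1_l, Rmult_1_r.
    apply weight_local; [exact Hn|exact Hj|exact HK|exact HnK|].
    replace (spin n j) with (/ rootn n * spin n j * rootn n) by (field; lra).
    rewrite Rpow_mult_distr, Hq4. apply Rmult_le_compat_r; [lra|].
    rewrite <- (Rabs_pos_eq (_ ^ 4)) by apply pow4_ge_0. rewrite <- RPow_abs.
    apply pow_incr. split; [apply Rabs_pos|apply HBK, Hb].
  - rewrite indicator_out by exact Hb. lra. }
replace (- (K ^ 4 + K ^ 6) / INR n) with (- ((K ^ 4 + K ^ 6) / INR n)) by (field; lra).
unfold cnt.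
split; rewrite (Rmult_comm (exp _)), Rmult_assoc; apply Rmult_le_compat_l; try exact Hh;
  rewrite Rmult_comm, scal_sum; apply sum_Rle; intros j Hj; apply Hw, Hj.
Qed.

(** [quartic_int] is positive at [1] and increasing. This makes the limit of the partition function,
    and hence [g], nonzero. *)
Lemma quartic_lim_pos (I : R) : is_lim quartic_int p_infty I -> 0 < I.
Proof.
intros H. destruct (Rlt_le_dec 0 I) as [L|L]; [exact L|exfalso].
assert (H1 := quartic_int_lt 1 Rlt_0_1).
destruct (proj2 (is_lim_spec _ _ _) H (mkposreal _ (proj1 H1))) as [M HM].
specialize (HM (Rmax 1 M + 1)). simpl in HM.
assert (Hx : M < Rmax 1 M + 1) by (generalize (Rmax_r 1 M); lra).
specialize (HM Hx). apply Rabs_def2 in HM.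
destruct (quartic_int_MVT 1 (Rmax 1 M + 1)) as [c [E _]]; [generalize (Rmax_l 1 M); lra|].
assert (0 <= quartic c * (Rmax 1 M + 1 - 1)).
{ apply Rmult_le_pos; [left; apply quartic_pos|generalize (Rmax_l 1 M); lra]. }
lra.
Qed.

Theorem theorem4p5 :
  forall (B : R -> Prop),
    Borel B ->
    relatively_compact B ->
    lebesgue_null (boundary B) ->
    forall (mB g : R),
      lebesgue_measure_is B mB ->
      Gamma_is (1/4) g ->
      Un_cv (fun n => sqrt (INR n) * cw_prob_scaled n B)
            (2 / (Rpower 12 (1/4) * g) * mB).
Proof.
intros B _ HB Hnull mB g HmB Hg.
apply is_lim_seq_Reals.
assert (HI := quartic_int_lim g Hg). assert (HIpos := quartic_lim_pos _ HI).
set (p := Rpower 12 (1 / 4)) in *.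
assert (Hp : 0 < p) by apply exp_pos.
assert (Hg0 : g <> 0) by (intros ->; lra).
assert (Hnum := numerator_lim B mB HB Hnull HmB).
assert (Hden := partition_lim _ HI).
(* With [q = rootn n] and [r = root4 n], the numerator carries [2 / q], the partition function
   [2 / r^3] and the claim [sqrt n = q^2]; the factor [(q / r)^3] reconciles them. *)
assert (Hratio : is_lim_seq (fun n => (rootn n / root4 n) ^ 3) 1).
{ replace (Finite 1) with (Finite (1 * (1 * (1 * 1)))) by (f_equal; ring).
  simpl. repeat (apply is_lim_seq_mult'; [exact rootn_root4_lim|]). apply is_lim_seq_const. }
(* The denominator is the integral of [quartic] over the whole line, twice the half-line value
   [p g / 4]. *)
replace (2 / (p * g) * mB) with (mB * 1 / (2 * (p * g / 4))) by (field; split; [exact Hg0|lra]).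
assert (Hquot := is_lim_seq_div' _ _ _ _ (is_lim_seq_mult' _ _ _ _ Hnum Hratio) Hden ltac:(lra)).
apply is_lim_seq_ext_loc with (2 := Hquot).
exists 1%nat. intros n Hn. rewrite cw_prob_scaled_weight, Rpower_opp_quarter.
assert (Hq := rootn_pos n). assert (Hr := root4_pos n).
rewrite <- (rootn_pow4 n) by lia.
replace (rootn n ^ 4) with ((rootn n ^ 2) ^ 2) by ring.
rewrite sqrt_pow2 by apply pow2_ge_0.
set (num := sum_f_R0 _ n).
set (den := sum_f_R0 (fun j => weight n j / center n) n).
replace (sum_f_R0 (fun j => 2 / root4 n ^ 3 * (weight n j / center n)) n)
  with (2 / root4 n ^ 3 * den).
2:{ unfold den. rewrite scal_sum. apply sum_eq. intros j _. ring. }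
assert (0 < den) by (apply tech1; intros; apply weight_div_pos).
field. lra.
Qed.
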